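(* Let $G$ be a finite abelian group of even order $v$. For any $(v,k,\lambda)$-SDS in $G$, the integer $k-\lambda$ is a perfect square.
   Context: Let $G$ be a finite group of order $v$, with identity denoted $0_G$. In the integral group ring $\mathbb Z[G]$, identify a subset $U\subseteq G$ with $\sum_{u\in U}u$, and for $D=\sum_{g\in G}a_g g$ write $D^{(-1)}=\sum_{g\in G}a_g g^{-1}$. A signed subset of $G$ is an element $D=\sum_{g\in G}a_g g\in\mathbb Z[G]$ with all $a_g\in\{0,1,-1\}$; its support size is $k=|\{g\in G: a_g\neq 0\}|$. A signed subset $D$ of support size $k$ is a $(v,k,\lambda)$-signed difference set (SDS), with $\lambda\in\mathbb Z$, if $DD^{(-1)}=(k-\lambda)0_G+\lambda G$ in $\mathbb Z[G]$ (so the coefficient of the identity is $k$ and every other coefficient is $\lambda$). *)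

(* Defs.v *)
From HB Require Import structures.
From mathcomp Require Import all_boot all_order all_algebra all_fingroup.

Set Implicit Arguments.
Unset Strict Implicit.
Unset Printing Implicit Defensive.

Import GRing.Theory.
Local Open Scope ring_scope.

(* The integral group ring Z[G]: D : Z[G] is the coefficient function of      *)
(* \sum_g (D g) g, and multiplication is convolution. The ambient group is    *)
(* the whole type gT.                                                         *)
Definition group_ring (gT : finGroupType) : Type := {ffun gT -> int}.

Definition gr_coef (gT : finGroupType) (A : group_ring gT) (g : gT) : int :=
  fun_of_fin A g.
Coercion gr_coef : group_ring >-> Funclass.

Section GroupRing.

Variable gT : finGroupType.
Local Notation ZG := (group_ring gT).
Implicit Types (A B C : ZG) (g h x : gT).

HB.instance Definition _ := GRing.Zmodule.copy ZG {ffun gT -> int}.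

Definition gr_elt (g : gT) : ZG := [ffun x => (x == g)%:R].

Definition gr_mul (A B : ZG) : ZG :=
  [ffun x => \sum_(h : gT) A h * B (h^-1 * x)%g].

Lemma gr_mulE A B x : gr_mul A B x = \sum_h A h * B (h^-1 * x)%g.
Proof. by rewrite /gr_mul /gr_coef ffunE. Qed.

Lemma gr_eltE g x : gr_elt g x = (x == g)%:R.
Proof. by rewrite /gr_elt /gr_coef ffunE. Qed.

Lemma gr_addE A B x : (A + B : ZG) x = A x + B x.
Proof. by rewrite /gr_coef ffunE. Qed.

Lemma gr_ext A B : (forall x, A x = B x) -> A = B.
Proof. by move=> eqAB; apply/ffunP. Qed.

Fact gr_mulA : associative gr_mul.
Proof.
move=> A B C; apply: gr_ext => x; rewrite !gr_mulE.
under [RHS]eq_bigr => h _ do rewrite gr_mulE big_distrl /=.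
rewrite exchange_big /=; apply: eq_bigr => g _.
rewrite gr_mulE big_distrr /= [RHS](reindex_inj (mulgI g)) /=.
by apply: eq_bigr => h _; rewrite mulrA mulKg invMg !mulgA.
Qed.

Fact gr_mul1 : left_id (gr_elt 1%g) gr_mul.
Proof.
move=> A; apply: gr_ext => x; rewrite gr_mulE (bigD1 1%g) //=.
rewrite gr_eltE eqxx mul1r invg1 mul1g big1 ?addr0 // => h /negPf nh.
by rewrite gr_eltE nh mul0r.
Qed.

Fact gr_mulr1 : right_id (gr_elt 1%g) gr_mul.
Proof.
move=> A; apply: gr_ext => x; rewrite gr_mulE (bigD1 x) //=.
rewrite gr_eltE mulVg eqxx mulr1 big1 ?addr0 // => h nh.
by rewrite gr_eltE -eq_mulVg1 (negPf nh) mulr0.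
Qed.

Fact gr_mulDl : left_distributive gr_mul +%R.
Proof.
move=> A B C; apply: gr_ext => x; rewrite gr_addE !gr_mulE -big_split /=.
by apply: eq_bigr => h _; rewrite gr_addE mulrDl.
Qed.

Fact gr_mulDr : right_distributive gr_mul +%R.
Proof.
move=> A B C; apply: gr_ext => x; rewrite gr_addE !gr_mulE -big_split /=.
by apply: eq_bigr => h _; rewrite gr_addE mulrDr.
Qed.

Fact gr_oner_neq0 : gr_elt 1%g != 0.
Proof.
apply/eqP => /(congr1 (fun A : ZG => A 1%g)).
by rewrite gr_eltE eqxx /gr_coef ffunE.
Qed.

HB.instance Definition _ := GRing.Zmodule_isNzRing.Build ZG
  gr_mulA gr_mul1 gr_mulr1 gr_mulDl gr_mulDr gr_oner_neq0.

Definition gr_set (U : {set gT}) : ZG := \sum_(u in U) gr_elt u.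

(* D^(-1) *)
Definition gr_inv (D : ZG) : ZG := \sum_(g : gT) gr_elt g^-1%g *~ D g.

Definition signed_subset (D : ZG) : Prop :=
  forall g, D g \in [:: 0; 1; -1].

Definition support_size (D : ZG) : nat := #|[set g | D g != 0]|.

Definition signed_difference_set (v k : nat) (lambda : int) (D : ZG) : Prop :=
  [/\ #|gT| = v,
      signed_subset D,
      support_size D = k
    & D * gr_inv D =
        gr_elt 1%g *~ (k%:Z - lambda) + gr_set [set: gT] *~ lambda].

End GroupRing.

(* Main.v *)
From HB Require Import structures.
Require Import Defs.
From mathcomp Require Import all_boot all_order all_algebra all_fingroup.
From mathcomp Require Import all_solvable.

(** The reason is a character of order two. An abelian group G of even order
    has a subgroup H of index 2 ([nilpotent_index_prime]); let chi : G -> Z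
    send H to 1 and the other coset to -1. Extended linearly, chi is a ring
    morphism from Z[G] to Z. Since chi takes the values 1 and -1 only,
    chi(g^-1) = chi(g), so D^(-1) and D have the same image m
    ([char_eval_inv]); since chi is not trivial, it sends the sum of all group
    elements to 0 ([sum_quad_char]). Applying chi to
    D D^(-1) = (k - lambda) 0_G + lambda G therefore gives m^2 = k - lambda.  *)

Set Implicit Arguments.
Unset Strict Implicit.
Unset Printing Implicit Defensive.

Import GRing.Theory Num.Theory.
Local Open Scope ring_scope.

(** When p divides the order of a nilpotent group, the quotient by its p'-part
    is a nontrivial p-group. A nontrivial solvable group has a normal subgroup
    of prime index, and in a p-group that prime can only be p. *)
Lemma nilpotent_index_prime (gT : finGroupType) (G : {group gT}) (p : nat) :
    nilpotent G -> prime p -> (p %| #|G|)%N ->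
  exists2 H : {group gT}, (H <| G)%g & #|G : H|%g = p.
Proof.
move=> nilG p_pr p_dv_G; set K := 'O_p^'(G)%G.
have nKG : (K <| G)%g := pcore_normal _ _.
have /and3P[_ p'K pGK] : (p^').-Hall(G)%g K := nilpotent_pcore_Hall _ nilG.
have ntGK : (G / K != 1)%g.
  apply: contraL p'K => /eqP/trivgP.
  rewrite quotient_sub1 ?normal_norm // => sGK.
  have eqKG : K = G by apply/val_inj/eqP; rewrite eqEsubset sGK normal_sub.
  by rewrite eqKG /pgroup p'natE // negbK.
have solGK : solvable (G / K)%g by apply: quotient_sol (nilpotent_sol nilG).
have [B nBG B_pr] := sol_prime_factor_exists solGK ntGK.
have [H defB sKH nHG] := inv_quotientN nKG nBG; exists H => //.
have eqi : #|G / K : B|%g = #|G : H|%g.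
  rewrite defB index_quotient_eq ?(normal_norm nKG) ?(normal_sub nHG) //.
  by rewrite subIset // sKH orbT.
rewrite eqi in B_pr; apply/eqP.
have : p.-nat #|G : H|%g.
  by rewrite -[p.-nat _]pnatNK; apply: pnat_dvd (indexgS _ sKH) pGK.
by rewrite pnatE // !inE.
Qed.

Section QuadraticCharacter.

Variables (gT : finGroupType) (H : {group gT}).
Hypothesis indexH : #|[set: gT] : H|%g = 2%N.

(** The sign is written as a power of -1 so that multiplicativity becomes a
    statement about the exclusive or of two membership tests. *)
Definition quad_char (x : gT) : int := (-1) ^+ (x \notin H).

Lemma quad_charM x y : quad_char (x * y)%g = quad_char x * quad_char y.
Proof.
rewrite /quad_char -signr_addb; congr (_ ^+ nat_of_bool _).
have [Hx | nHx] := boolP (x \in H); first by rewrite groupMl.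
have [Hy | nHy] := boolP (y \in H); first by rewrite groupMr.
(* Two elements outside H lie in one coset, that of y^-1. *)
have : x \in [set: gT] :\: H by rewrite !inE nHx.
rewrite -(rcoset_index2 (subsetT _) indexH (x := y^-1%g)) ?inE ?groupV ?nHy //.
by rewrite mem_rcoset invgK => ->.
Qed.

Lemma quad_charV x : quad_char x^-1%g = quad_char x.
Proof. by rewrite /quad_char groupV. Qed.

Lemma quad_char1 : quad_char 1%g = 1.
Proof. by rewrite /quad_char group1. Qed.

(** Translation by an element outside [H] changes the sign of every term, so
    the sum equals its opposite. *)
Lemma sum_quad_char : \sum_x quad_char x = 0.
Proof.
have [y nHy] : exists y, y \notin H.
  apply/existsP; apply: contraPT indexH => /existsPn sGH.
  suff -> : [set: gT] = H by rewrite indexgg.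
  by apply/setP => x; rewrite inE; move: (sGH x); rewrite negbK => ->.
apply/eqP; rewrite -eqNr; apply/eqP; symmetry.
rewrite {1}(reindex_inj (mulgI y)) /= -sumrN; apply: eq_bigr => x _.
by rewrite quad_charM {1}/quad_char nHy mulN1r.
Qed.

End QuadraticCharacter.

Section Evaluation.

Variables (gT : finGroupType) (chi : gT -> int).

Definition char_eval (A : group_ring gT) : int := \sum_g A g * chi g.

Fact char_eval_is_nmod_morphism : nmod_morphism char_eval.
Proof.
split=> [|A B]; last first.
  rewrite -big_split; apply: eq_bigr => g _.
  by rewrite gr_addE mulrDl.
by apply: big1 => g _; rewrite /gr_coef ffunE mul0r.
Qed.

HB.instance Definition _ := GRing.isNmodMorphism.Build
  (group_ring gT) int char_eval char_eval_is_nmod_morphism.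

Lemma char_eval_elt g : char_eval (gr_elt g) = chi g.
Proof.
rewrite /char_eval (bigD1 g) //= gr_eltE eqxx mul1r.
rewrite big1 ?addr0 // => h /negPf nh.
by rewrite gr_eltE nh mul0r.
Qed.

Lemma char_eval_setT : char_eval (gr_set [set: gT]) = \sum_g chi g.
Proof.
rewrite raddf_sum; apply: eq_big => [g | g _]; first by rewrite inE.
exact: char_eval_elt.
Qed.

(** Values fixed by inversion are what make a character send D^(-1) to the
    same integer as D; for a complex character it would be the conjugate. *)
Lemma char_eval_inv D : (forall x, chi x^-1%g = chi x) ->
  char_eval (gr_inv D) = char_eval D.
Proof.
move=> chiV; rewrite raddf_sum; apply: eq_bigr => g _.
by rewrite raddfMz /= char_eval_elt chiV mulrzz mulrC.
Qed.

Lemma char_evalM (A B : group_ring gT) :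
    (forall x y, chi (x * y)%g = chi x * chi y) ->
  char_eval (A * B) = char_eval A * char_eval B.
Proof.
move=> chiM; rewrite /char_eval big_distrl /=.
under eq_bigr => x _ do rewrite gr_mulE big_distrl /=.
rewrite exchange_big /=; apply: eq_bigr => h _.
rewrite big_distrr /= (reindex_inj (mulgI h)); apply: eq_bigr => x _.
by rewrite mulKg chiM mulrACA.
Qed.

End Evaluation.

Theorem theorem4p2 (gT : finGroupType) (v k : nat) (lambda : int)
    (D : group_ring gT)
    (abelian_G : abelian [set: gT]) (v_order : #|gT| = v) (v_even : ~~ odd v)
    (sds_D : signed_difference_set v k lambda D) :
  exists m : int, k%:Z - lambda = m ^+ 2.
Proof.
have [H _ indexH] : exists2 H : {group gT},
    (H <| [set: gT])%g & #|[set: gT] : H|%g = 2%N.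
  apply: (nilpotent_index_prime (G := [set: gT]%G)) => //.
    exact: abelian_nil.
  by rewrite cardsT v_order dvdn2.
case: sds_D => _ _ _ /(congr1 (char_eval (quad_char H))).
rewrite (char_evalM _ _ (quad_charM indexH)).
rewrite (char_eval_inv _ (@quad_charV _ H)) raddfD !raddfMz /=.
rewrite char_eval_elt quad_char1 char_eval_setT (sum_quad_char indexH).
rewrite mul0rz addr0 mulrzz mul1r => eqm.
by exists (char_eval (quad_char H) D); rewrite expr2 eqm.
Qed.
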